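(* Let $k$ be a field. (a) A morphism $p\colon\mathfrak A\to\mathfrak C$ in $\mathsf{Top}^{\mathsf{sc}}_{\mathbb Z}$ is a semi-stable cokernel if and only if $p$ is a surjective open map. (b) A morphism $p\colon\mathfrak V\to\mathfrak W$ in $\mathsf{Top}^{\mathsf{sc}}_k$ is a semi-stable cokernel if and only if $p$ is a surjective open map.
   Context: All topological abelian groups have linear topology: open subgroups form a base of neighborhoods of zero. All topological $k$-vector spaces ($k$ a fixed field with the discrete topology) have linear topology: open vector subspaces form a base of neighborhoods of zero. The completion of $A$ is $A^{\wedge}=\varprojlim_{U\subset A}A/U$, with $U$ ranging over the open subgroups (resp. subspaces), topologized so that the kernels of the projections $A^{\wedge}\to A/U$ form a base of neighborhoods of zero. $A$ is separated (resp. complete) if the natural map $A\to A^{\wedge}$ is injective (resp. surjective). $\mathsf{Top}^{\mathsf{sc}}_{\mathbb Z}$ (resp. $\mathsf{Top}^{\mathsf{sc}}_k$) is the category of complete, separated topological abelian groups and continuous homomorphisms (resp. complete, separated topological $k$-vector spaces and continuous $k$-linear maps). These are additive categories in which all kernels and cokernels exist. In an additive category, a morphism is called a cokernel if it is a cokernel of some morphism. A morphism $A\to A''$ is a semi-stable cokernel if for every morphism $C''\to A''$ the pullback $C=C''\sqcap_{A''}A$ exists and the natural morphism $C\to C''$ is a cokernel. *)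

(* Defs.v *)
From HB Require Import structures.
From mathcomp Require Import all_boot all_order all_algebra.
From mathcomp Require Import all_classical topology pseudometric_normed_Zmodule.
From mathcomp Require Import tvs.

Set Implicit Arguments.
Unset Strict Implicit.
Unset Printing Implicit Defensive.

Import GRing.Theory.

Local Open Scope classical_set_scope.
Local Open Scope ring_scope.

(* Cokernels, pullbacks and semi-stable cokernels only involve the composition
   and the additive structure of the Hom groups, so they are defined in any
   preadditive category, in particular in any additive one. *)
Record preadditiveCategory := PreadditiveCategory {
  obj :> Type;
  hom : obj -> obj -> zmodType;
  idm : forall A : obj, hom A A;
  compm : forall A B C : obj, hom B C -> hom A B -> hom A C;
  compmA : forall (A B C D : obj) (h : hom C D) (g : hom B C) (f : hom A B),
    compm h (compm g f) = compm (compm h g) f;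
  comp1m : forall (A B : obj) (f : hom A B), compm (idm B) f = f;
  compm1 : forall (A B : obj) (f : hom A B), compm f (idm A) = f;
  compmDl : forall (A B C : obj) (g g' : hom B C) (f : hom A B),
    compm (g + g') f = compm g f + compm g' f;
  compmDr : forall (A B C : obj) (g : hom B C) (f f' : hom A B),
    compm g (f + f') = compm g f + compm g f' }.

Section SemiStableCokernel.
Variable K : preadditiveCategory.

Definition is_cokernel_of (A B C : K) (f : hom A B) (p : hom B C) : Prop :=
  compm p f = 0 /\
  forall (D : K) (g : hom B D), compm g f = 0 ->
    exists! h : hom C D, compm h p = g.

Definition is_cokernel (B C : K) (p : hom B C) : Prop :=
  exists (A : K) (f : hom A B), is_cokernel_of f p.

Definition is_pullback (A B C P : K) (f : hom B A) (g : hom C A)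
    (q1 : hom P B) (q2 : hom P C) : Prop :=
  compm f q1 = compm g q2 /\
  forall (Q : K) (r1 : hom Q B) (r2 : hom Q C), compm f r1 = compm g r2 ->
    exists! u : hom Q P, compm q1 u = r1 /\ compm q2 u = r2.

Definition is_semistable_cokernel (A A2 : K) (p : hom A A2) : Prop :=
  forall (C2 : K) (f : hom C2 A2),
    exists (C : K) (q1 : hom C C2) (q2 : hom C A),
      is_pullback f p q1 q2 /\ is_cokernel q1.

End SemiStableCokernel.

Definition open_map (S T : topologicalType) (f : S -> T) : Prop :=
  forall U : set S, open U -> open (f @` U).

(* For a family B of subgroups of A, an element of the quotient A / U is
   represented by the coset it is.  The index type of families is the set B
   itself, seen as a type. *)
Section Completion.
Variables (A : zmodType) (B : set (set A)).

Definition coset (U : set A) (a : A) : set A := [set a + u | u in U].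

(* The projective limit of the A / U: the transition map A / U -> A / V, for
   U contained in V, sends a + U to a + V. *)
Definition completion : set (B -> set A) :=
  [set x | (forall U : B, range (coset (val U)) (x U)) /\
    (forall U V : B, val U `<=` val V ->
       forall a : A, x U = coset (val U) a -> x V = coset (val V) a)].

Definition to_completion (a : A) : B -> set A := fun U => coset (val U) a.

Definition separated_wrt : Prop := injective to_completion.

Definition complete_wrt : Prop := set_surj [set: A] completion to_completion.

End Completion.

Definition neighborhood_base0 (A : topologicalZmodType) (B : set (set A)) :=
  forall W : set A, nbhs (0 : A) W <-> exists2 U : set A, B U & U `<=` W.

Definition open_subgroups (A : topologicalZmodType) : set (set A) :=
  [set U : set A | GRing.zmod_closed (mem U) /\ open U].

Record topscZ := TopscZObject {
  topscZ_sort :> topologicalZmodType;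
  topscZ_linear : neighborhood_base0 (@open_subgroups topscZ_sort);
  topscZ_separated : separated_wrt (@open_subgroups topscZ_sort);
  topscZ_complete : complete_wrt (@open_subgroups topscZ_sort) }.

Lemma continuousB_fun (S : topologicalType) (A : topologicalZmodType)
  (f g : S -> A) : continuous f -> continuous g -> continuous (f - g).
Proof.
move=> fc gc x; apply: (@continuous_comp _ _ _ (fun x => (f x, g x))
  (fun z : A * A => z.1 - z.2)); last exact: sub_continuous.
by apply: cvg_pair; [exact: fc|exact: gc].
Qed.

Section ContinuousAdditive.
Variables A B : topologicalZmodType.

Definition cadditive_pred : {pred A -> B} :=
  [pred f : A -> B | `[< zmod_morphism f /\ continuous f >]].

Record cadditive := CAdditive {
  cadditive_fun :> A -> B;
  cadditiveP : cadditive_fun \in cadditive_pred }.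

HB.instance Definition _ := [isSub for cadditive_fun].
HB.instance Definition _ := [Choice of cadditive by <:].

Lemma cadditive_zmod_closed : zmod_closed cadditive_pred.
Proof.
split=> [|f g /asboolP[fa fc] /asboolP[ga gc]]; apply/asboolP; split.
- by move=> x y /=; rewrite subr0.
- by move=> x; apply: cvg_cst.
- by move=> x y; rewrite !fctE fa ga !opprD addrACA.
- exact: continuousB_fun.
Qed.

HB.instance Definition _ :=
  GRing.isZmodClosed.Build (A -> B) cadditive_pred cadditive_zmod_closed.
HB.instance Definition _ := [SubChoice_isSubZmodule of cadditive by <:].

End ContinuousAdditive.

Lemma cadditive_id_subproof (A : topologicalZmodType) :
  (@id A : A -> A) \in @cadditive_pred A A.
Proof. by apply/asboolP; split=> // x; exact: cvg_id. Qed.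

Definition cadditive_id (A : topologicalZmodType) : cadditive A A :=
  CAdditive (cadditive_id_subproof A).

Lemma cadditive_comp_subproof (A B C : topologicalZmodType)
  (g : cadditive B C) (f : cadditive A B) :
  (g \o f : A -> C) \in @cadditive_pred A C.
Proof.
have /asboolP[fa fc] := cadditiveP f; have /asboolP[ga gc] := cadditiveP g.
apply/asboolP; split=> [x y|x] /=; first by rewrite fa ga.
by apply: continuous_comp; [exact: fc|exact: gc].
Qed.

Definition cadditive_comp (A B C : topologicalZmodType)
    (g : cadditive B C) (f : cadditive A B) : cadditive A C :=
  CAdditive (cadditive_comp_subproof g f).

Lemma cadditive_compDr (A B C : topologicalZmodType)
    (g : cadditive B C) (f f' : cadditive A B) :
  cadditive_comp g (f + f') = cadditive_comp g f + cadditive_comp g f'.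
Proof.
apply/val_inj/funext => x; have /asboolP[ga _] := cadditiveP g.
have gN y : g (- y) = - g y by rewrite -sub0r ga -(subrr 0) ga subrr sub0r.
by rewrite /= !fctE /= -[in LHS](opprK (f' x)) ga gN opprK.
Qed.

Definition TopscZ : preadditiveCategory :=
  @PreadditiveCategory topscZ (fun A B => cadditive A B)
    (fun A => cadditive_id A) (fun A B C => @cadditive_comp A B C)
    ltac:(by move=> *; exact: val_inj) ltac:(by move=> *; exact: val_inj)
    ltac:(by move=> *; exact: val_inj) ltac:(by move=> *; exact: val_inj)
    (fun A B C => @cadditive_compDr A B C).

(* The library's topologicalLmodType requires a numDomainType of scalars, while
   here the scalars form an arbitrary field with the discrete topology.  A plain
   record is used because a new HB join of Topological and Lmodule over a
   fieldType clashes with the existing joins over a numDomainType. *)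
Record topologicalVectType (k : fieldType) := TopologicalVectType {
  tv_zmod : topologicalZmodType;
  tv_scale : k -> tv_zmod -> tv_zmod;
  tv_scalerA : forall (a b : k) (v : tv_zmod),
    tv_scale a (tv_scale b v) = tv_scale (a * b) v;
  tv_scale1r : left_id 1 tv_scale;
  tv_scalerDr : right_distributive tv_scale +%R;
  tv_scalerDl : forall v : tv_zmod,
    {morph tv_scale^~ v : a b / a + b >-> a + b};
  tv_scale_continuous : continuous
    (fun z : discrete_topology k * tv_zmod => tv_scale z.1 z.2) }.

Definition tv_sort (k : fieldType) (V : topologicalVectType k) : Type :=
  tv_zmod V.
Coercion tv_sort : topologicalVectType >-> Sortclass.

HB.instance Definition _ (k : fieldType) (V : topologicalVectType k) :=
  TopologicalZmodule.copy (tv_sort V) (tv_zmod V).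
HB.instance Definition _ (k : fieldType) (V : topologicalVectType k) :=
  GRing.Zmodule_isLmodule.Build k (tv_sort V)
    (@tv_scalerA k V) (@tv_scale1r k V) (@tv_scalerDr k V) (@tv_scalerDl k V).

Definition open_subspaces (k : fieldType) (V : topologicalVectType k) :
    set (set V) :=
  [set U : set V | GRing.submod_closed (mem U) /\ open U].

Record topsck (k : fieldType) := TopsckObject {
  topsck_sort :> topologicalVectType k;
  topsck_linear : neighborhood_base0 (@open_subspaces k topsck_sort);
  topsck_separated : separated_wrt (@open_subspaces k topsck_sort);
  topsck_complete : complete_wrt (@open_subspaces k topsck_sort) }.

Section ContinuousLinear.
Variables (k : fieldType) (V W : topologicalVectType k).

Definition clinear_pred : {pred V -> W} :=
  [pred f : V -> W | `[< linear f /\ continuous f >]].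

Record clinear := CLinear {
  clinear_fun :> V -> W;
  clinearP : clinear_fun \in clinear_pred }.

HB.instance Definition _ := [isSub for clinear_fun].
HB.instance Definition _ := [Choice of clinear by <:].

Lemma clinear_zmod_closed : zmod_closed clinear_pred.
Proof.
split=> [|f g /asboolP[fl fc] /asboolP[gl gc]]; apply/asboolP; split.
- by move=> a x y; rewrite /= scaler0 addr0.
- by move=> x; apply: cvg_cst.
- by move=> a x y; rewrite !fctE fl gl scalerBr opprD addrACA.
- exact: continuousB_fun.
Qed.

HB.instance Definition _ :=
  GRing.isZmodClosed.Build (V -> W) clinear_pred clinear_zmod_closed.
HB.instance Definition _ := [SubChoice_isSubZmodule of clinear by <:].

End ContinuousLinear.

Lemma clinear_id_subproof (k : fieldType) (V : topologicalVectType k) :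
  (@id V : V -> V) \in @clinear_pred k V V.
Proof. by apply/asboolP; split=> // x; exact: cvg_id. Qed.

Definition clinear_id (k : fieldType) (V : topologicalVectType k) :
    clinear V V :=
  CLinear (clinear_id_subproof V).

Lemma clinear_comp_subproof (k : fieldType) (U V W : topologicalVectType k)
  (g : clinear V W) (f : clinear U V) :
  (g \o f : U -> W) \in @clinear_pred k U W.
Proof.
have /asboolP[fl fc] := clinearP f; have /asboolP[gl gc] := clinearP g.
apply/asboolP; split=> [a x y|x] /=; first by rewrite fl gl.
by apply: continuous_comp; [exact: fc|exact: gc].
Qed.

Definition clinear_comp (k : fieldType) (U V W : topologicalVectType k)
    (g : clinear V W) (f : clinear U V) : clinear U W :=
  CLinear (clinear_comp_subproof g f).

Lemma clinear_compDr (k : fieldType) (U V W : topologicalVectType k)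
    (g : clinear V W) (f f' : clinear U V) :
  clinear_comp g (f + f') = clinear_comp g f + clinear_comp g f'.
Proof.
apply/val_inj/funext => x; have /asboolP[gl _] := clinearP g.
by rewrite /= !fctE /= -[in LHS](scale1r (f x)) gl scale1r.
Qed.

Definition Topsck (k : fieldType) : preadditiveCategory :=
  @PreadditiveCategory (topsck k) (fun V W => clinear V W)
    (fun V => clinear_id V) (fun U V W => @clinear_comp k U V W)
    ltac:(by move=> *; exact: val_inj) ltac:(by move=> *; exact: val_inj)
    ltac:(by move=> *; exact: val_inj) ltac:(by move=> *; exact: val_inj)
    (fun U V W => @clinear_compDr k U V W).

(* Main.v *)
From HB Require Import structures.
From mathcomp Require Import all_boot all_order all_algebra.
From mathcomp Require Import all_classical topology pseudometric_normed_Zmodule.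
From mathcomp Require Import tvs.
Require Import Defs.

(** Both parts are one argument about a concrete category of topological groups
    ([semistable_cokernelP]), which uses only four facts about the category.

    Suppose that [p : A -> C] is a semi-stable cokernel.
    - Surjectivity.  A point [c] of [C] is the value at [e] of a morphism
      [G -> C] from a discrete object: the integers, or the field of scalars,
      with [e = 1].  The projection [q] of the fibre product of [G] and [A] over
      [C] to [G] is a cokernel, hence an epimorphism.  As [G] is discrete, its
      quotient by the image of [q] is again an object of the category, and the
      map from [G] to this quotient vanishes after [q]; so it is zero, [q] is
      surjective, and the [A]-component of a preimage of [e] is a preimage of
      [c].  This discreteness is the point: in general a cokernel in the
      category only has a dense image, because the quotient has to be completed.
    - Openness.  The pullback of [p] along the identity of [C] is [p] up to
      isomorphism, so [p] is a cokernel of some [f : B -> A].  For an open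
      subgroup [U] of [A], the quotient of [A] by [U + f(B)] is discrete, and
      the map from [A] to it factors as [h \o p].  The kernel of [h] is open, and
      it lies in [p(U)] because [p] is surjective.

    Conversely, let [p] be surjective and open.  Both properties pass to its
    pullbacks, which are the fibre products with the topology induced by the
    product.  A surjective open morphism is a cokernel of the difference of the
    two projections of its kernel pair: the image of this difference is the whole
    kernel, and a morphism which vanishes on the kernel descends to a continuous
    map because the target has the quotient topology.

    What remains is to supply, in each category, the discrete objects, their
    quotients, and the completeness of fibre products.  For the last one,
    completeness is restated as the existence of limits of coherent families of
    points indexed by the basic open subgroups ([complete_wrtP]); a coherent
    family in a fibre product has a limit in each factor, and these two limits
    have the same image in the base because the base is separated
    ([fibre_linearly_complete]). *)

Set Implicit Arguments.
Unset Strict Implicit.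
Unset Printing Implicit Defensive.

Import GRing.Theory.

Local Open Scope classical_set_scope.
Local Open Scope ring_scope.
Local Open Scope quotient_scope.

(** * Additive maps between topological groups *)

Lemma zmod_morphism0 (A B : zmodType) (f : A -> B) : zmod_morphism f -> f 0 = 0.
Proof. by move=> fB; rewrite -(subrr 0) fB subrr. Qed.

Lemma zmod_morphismD (A B : zmodType) (f : A -> B) :
  zmod_morphism f -> {morph f : x y / x + y}.
Proof.
move=> fB x y; rewrite -[in LHS](opprK y) -(sub0r y) !fB (zmod_morphism0 fB).
by rewrite sub0r opprK.
Qed.

Lemma nbhs_translate (A : topologicalZmodType) (x y : A) (W : set A) :
  nbhs (x + y) W -> nbhs y [set z | W (x + z)].
Proof.
have c : continuous (fun z : A => x + z).
  move=> z; apply: (@continuous_comp _ _ _ (fun z => (x, z))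
    (fun z : A * A => z.1 + z.2)); last exact: add_continuous.
  by apply: cvg_pair; [exact: cvg_cst|exact: cvg_id].
by move=> /(c y).
Qed.

Lemma nbhs_translate0 (A : topologicalZmodType) (x : A) (W : set A) :
  nbhs x W <-> nbhs 0 [set z | W (x + z)].
Proof.
split=> [Wx|W0]; first by apply: nbhs_translate; rewrite addr0.
have /nbhs_translate : nbhs (- x + x) [set z | W (x + z)] by rewrite addNr.
by congr nbhs; apply/seteqP; split=> z /=; rewrite addrA subrr add0r.
Qed.

Lemma kernel_nbhs_continuous (A D : topologicalZmodType) (h : A -> D) :
  zmod_morphism h -> nbhs 0 [set a | h a = 0] -> continuous h.
Proof.
move=> hB h0 x W /nbhs_singleton Wx; apply: (nbhs_translate0 _ _).2.
by apply: filterS h0 => a /= ha; rewrite zmod_morphismD// ha addr0.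
Qed.

(** A surjective open map carries the quotient topology, so that continuous maps
    which are constant on its fibres descend continuously. *)
Lemma surj_open_quotient (A C D : topologicalZmodType) (p : A -> C)
    (g : A -> D) :
  set_surj [set: A] [set: C] p -> open_map p -> zmod_morphism p ->
  zmod_morphism g -> continuous g -> (forall a, p a = 0 -> g a = 0) ->
  exists2 h : C -> D, continuous h & forall a, h (p a) = g a.
Proof.
move=> psurj pop pB gB gc pg.
have /choice[s sK] : forall c, exists a, p a = c.
  by move=> c; have [a _ <-] := psurj c I; exists a.
have hE a : g (s (p a)) = g a.
  by apply/eqP; rewrite -subr_eq0 -gB; apply/eqP/pg; rewrite pB sK subrr.
exists (g \o s) => //; apply/continuousP => O oO.
suff -> : (g \o s) @^-1` O = p @` (g @^-1` O).
  by apply: pop; move/continuousP: gc; apply.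
apply/seteqP; split=> [c Oc|_ [a Oa <-]] /=; last by rewrite hE.
by exists (s c).
Qed.

(** * Semi-stable cokernels in a concrete category of topological groups *)

Section ConcreteCategory.
Variables (K : preadditiveCategory) (T : K -> topologicalZmodType).
Variable app : forall A B : K, hom A B -> T A -> T B.

Hypothesis app_inj : forall (A B : K) (f g : hom A B), app f =1 app g -> f = g.
Hypothesis app_comp : forall (A B C : K) (g : hom B C) (f : hom A B) a,
  app (compm g f) a = app g (app f a).
Hypothesis app_sub : forall (A B : K) (f g : hom A B) a,
  app (f - g) a = app f a - app g a.
Hypothesis app_zmod : forall (A B : K) (f : hom A B), zmod_morphism (app f).
Hypothesis app_cont : forall (A B : K) (f : hom A B), continuous (app f).

(** The discrete objects of the category detect points. *)
Hypothesis discrete_generator : forall (A : K) (a : T A),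
  exists (G : K) (e : T G) (f : hom G A), nbhs 0 [set (0 : T G)] /\ app f e = a.

(** Each [W] contains an open subobject [U], and [D] stands for the quotient
    of [A] by [U + f(B)]: it is discrete, hence complete, although the quotient
    by [f(B)] alone need not be. *)
Hypothesis discrete_quotient : forall (B A : K) (f : hom B A) (W : set (T A)),
  nbhs 0 W -> exists (D : K) (g : hom A D),
    [/\ nbhs 0 [set (0 : T D)], compm g f = 0
      & forall a, app g a = 0 -> exists b, W (a - app f b)].

(** Pullbacks are the set-theoretic fibre products, with the topology induced
    by the product. *)
Hypothesis pullback : forall (A B C : K) (f : hom B C) (g : hom A C),
  exists (P : K) (q1 : hom P B) (q2 : hom P A),
    [/\ is_pullback f g q1 q2,
        forall b a, app f b = app g a -> exists x, app q1 x = b /\ app q2 x = a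
      & forall W, nbhs 0 W -> exists U V, [/\ nbhs 0 U, nbhs 0 V
          & app q1 @^-1` U `&` app q2 @^-1` V `<=` W]].

Hypothesis descent : forall (A C D : K) (p : hom A C) (g : hom A D),
  set_surj [set: T A] [set: T C] (app p) -> open_map (app p) ->
  (forall a, app p a = 0 -> app g a = 0) -> exists h : hom C D, compm h p = g.

Let app0z (A B : K) a : app (0 : hom A B) a = 0.
Proof. by rewrite -(subrr 0) app_sub subrr. Qed.

Let appz0 (A B : K) (f : hom A B) : app f 0 = 0.
Proof. exact: zmod_morphism0. Qed.

Let comp0m (A B C : K) (f : hom A B) : compm (0 : hom B C) f = 0.
Proof. by apply: app_inj => a; rewrite app_comp !app0z. Qed.

Lemma cokernel_epi (A B : K) (p : hom A B) :
  is_cokernel p -> forall (D : K) (g : hom B D), compm g p = 0 -> g = 0.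
Proof.
move=> [X [f [pf0 pU]]] D g gp0.
have [|h [_ hU]] := pU D 0; first exact: comp0m.
by rewrite -(hU g gp0); apply: hU; exact: comp0m.
Qed.

(** The quotient of a discrete object by an image needs no completion, so that
    an epimorphism onto a discrete object hits every point. *)
Lemma cokernel_discrete_surj (P G : K) (q : hom P G) :
  is_cokernel q -> nbhs 0 [set (0 : T G)] -> forall e, exists x, app q x = e.
Proof.
move=> qc G0 e; have [D [g [_ gq gker]]] := discrete_quotient q G0.
have /gker[x /= /eqP] : app g e = 0 by rewrite (cokernel_epi qc gq) app0z.
by rewrite subr_eq0 => /eqP ->; exists x.
Qed.

(** The pullback of [p] along a morphism which takes the value [c] contains a
    preimage of [c] as soon as its projection is surjective. *)
Lemma semistable_surj (A C : K) (p : hom A C) :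
  is_semistable_cokernel p -> forall c, exists a, app p a = c.
Proof.
move=> pss c; have [G [e [f [G0 fe]]]] := discrete_generator c.
have [P [q1 [q2 [[sq _] q1c]]]] := pss G f.
have [x q1x] := cokernel_discrete_surj q1c G0 e.
by exists (app q2 x); rewrite -app_comp -sq app_comp q1x.
Qed.

(** The pullback of [p] along the identity is isomorphic to [p]: its projection
    [q2] to [A] has the section [s], through which the factorizations over [q1]
    become factorizations over [p]. *)
Lemma semistable_cokernel (A C : K) (p : hom A C) :
  is_semistable_cokernel p -> is_cokernel p.
Proof.
move=> pss; have [P [q1 [q2 [[sq sqU] [B [f [q1f q1U]]]]]]] := pss C (idm C).
have q1E : q1 = compm p q2 by rewrite -sq comp1m.
have [|s [[q1s q2s] _]] := sqU A p (idm A); first by rewrite comp1m compm1.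
exists B, (compm q2 f); split=> [|D g gf].
  by rewrite compmA -q1E q1f.
have [|h [hq hU]] := q1U D (compm g q2); first by rewrite -compmA.
exists h; split=> [|h' hp].
  by rewrite -[RHS]compm1 -q2s compmA -hq -compmA q1s.
by apply: hU; rewrite q1E compmA hp.
Qed.

(** With [p] a cokernel of [f], the morphism [g] that the discrete quotients
    give for [f] and a neighbourhood [W] of zero is [h] after [p], and the
    kernel of [h] is a neighbourhood of zero contained in [p(W)]. *)
Lemma surj_cokernel_open (A C : K) (p : hom A C) :
  is_cokernel p -> (forall c, exists a, app p a = c) -> open_map (app p).
Proof.
move=> [B [f [pf pU]]] psurj U oU; rewrite openE => _ [a Ua <-].
have W0 : nbhs 0 [set w | U (a + w)].
  by apply: (nbhs_translate0 a U).1; apply: open_nbhs_nbhs.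
have [D [g [D0 gf gker]]] := discrete_quotient f W0.
have [h [hp _]] := pU D g gf.
apply: (nbhs_translate0 _ _).2.
have : nbhs 0 (app h @^-1` [set 0]) by apply: app_cont; rewrite appz0.
apply: filterS => c /= hc; have [a' pa'] := psurj c.
have /gker[b /= Uab] : app g a' = 0 by rewrite -hp app_comp pa'.
exists (a + (a' - app f b)) => //.
by rewrite zmod_morphismD// app_zmod pa' -app_comp pf app0z subr0.
Qed.

(** A surjective open morphism is a cokernel of the difference of the two
    projections of its kernel pair: the points [(a, 0)] of the kernel pair, for
    [a] in the kernel of [p], show that the image of this difference contains
    the kernel. *)
Lemma surj_open_cokernel (A C : K) (p : hom A C) :
  (forall c, exists a, app p a = c) -> open_map (app p) -> is_cokernel p.
Proof.
move=> psurj pop; have [P [q1 [q2 [[sq _] cov _]]]] := pullback p p.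
exists P, (q1 - q2); split=> [|D g gq].
  apply: app_inj => x; rewrite app_comp app_sub app_zmod -!app_comp sq subrr.
  by rewrite app0z.
have psurj' : set_surj [set: T A] [set: T C] (app p).
  by move=> c _; have [a pa] := psurj c; exists a.
(* From [compm g (q1 - q2) = 0], [g] vanishes on the kernel of [p]. *)
have [|h hp] := descent (g := g) psurj' pop.
  move=> a pa; have [|x [q1x q2x]] := cov a 0; first by rewrite pa appz0.
  by rewrite -(subr0 a) -q1x -q2x -app_sub -app_comp gq app0z.
exists h; split=> // h' h'p; apply: app_inj => c; have [a <-] := psurj c.
by rewrite -!app_comp hp h'p.
Qed.

(** A basic neighbourhood of zero of the fibre product, given by [U] and [V],
    has image [U `&` f @^-1` (p @` V)] under the first projection. *)
Lemma pullback_open_map (A B C P : K) (f : hom B C) (p : hom A C)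
    (q1 : hom P B) (q2 : hom P A) :
  compm f q1 = compm p q2 ->
  (forall b a, app f b = app p a -> exists x, app q1 x = b /\ app q2 x = a) ->
  (forall W, nbhs 0 W -> exists U V, [/\ nbhs 0 U, nbhs 0 V
    & app q1 @^-1` U `&` app q2 @^-1` V `<=` W]) ->
  open_map (app p) -> open_map (app q1).
Proof.
move=> sq cov base pop O oO; rewrite openE => _ [x Ox <-].
have [U [V [U0 V0 UVO]]] : exists U V, [/\ nbhs 0 U, nbhs 0 V
    & app q1 @^-1` U `&` app q2 @^-1` V `<=` [set z | O (x + z)]].
  by apply: base; apply: (nbhs_translate0 _ _).1; apply: open_nbhs_nbhs.
apply: (nbhs_translate0 _ _).2.
have pV0 : nbhs 0 (app p @` V).
  move: V0; rewrite nbhsE => -[V' [oV' V'0] V'V].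
  apply: (@filterS _ _ _ (app p @` V')); first exact: image_subset.
  by apply: open_nbhs_nbhs; split; [exact: pop|exists 0].
have : nbhs 0 (U `&` app f @^-1` (app p @` V)).
  by apply: filterI => //; apply: app_cont; rewrite appz0.
apply: filterS => b [Ub [a Va pa]].
have [y [q1y q2y]] := cov b a (esym pa).
exists (x + y); last by rewrite zmod_morphismD// q1y.
by apply: UVO; split; rewrite /= ?q1y ?q2y.
Qed.

Theorem semistable_cokernelP (A C : K) (p : hom A C) :
  is_semistable_cokernel p <->
  set_surj [set: T A] [set: T C] (app p) /\ open_map (app p).
Proof.
split=> [pss|[psurj pop] B f].
  split; first by move=> c _; have [a] := semistable_surj pss c; exists a.
  apply: surj_cokernel_open; first exact: semistable_cokernel.
  exact: semistable_surj.
have [P [q1 [q2 [pb cov base]]]] := pullback f p; exists P, q1, q2; split=> //.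
have [sq _] := pb.
apply: surj_open_cokernel; last exact: pullback_open_map sq cov base pop.
move=> b; have [a _ pa] := psurj (app f b) I.
by have [x [q1x _]] := cov b a (esym pa); exists x.
Qed.

End ConcreteCategory.

(** * Separation and completeness for families of subgroups *)

Section Subgroup.
Variables (A : zmodType) (U : set A).
Hypothesis Uz : GRing.zmod_closed (mem U).

Lemma subgroup0 : U 0.
Proof. by have [/set_mem] := Uz. Qed.

Lemma subgroupB x y : U x -> U y -> U (x - y).
Proof.
by move=> Ux Uy; apply/set_mem; have [_] := Uz; apply; exact: mem_set.
Qed.

Lemma subgroupN x : U x -> U (- x).
Proof. by rewrite -sub0r; apply: subgroupB; exact: subgroup0. Qed.

Lemma subgroupD x y : U x -> U y -> U (x + y).
Proof. by move=> Ux Uy; rewrite -[y]opprK; apply/subgroupB/subgroupN. Qed.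

Lemma eq_cosetP x y : coset U x = coset U y <-> U (x - y).
Proof.
split=> [xy|Uxy].
  have : coset U x x by exists 0; [exact: subgroup0|exact: addr0].
  by rewrite xy => -[u Uu <-]; rewrite addrC addKr.
apply/seteqP; split=> _ [u Uu <-].
  by exists (x - y + u); [exact: subgroupD|rewrite addrA subrKC].
exists (u - (x - y)); first exact: subgroupB.
by rewrite opprB addrCA subrKC addrC.
Qed.

End Subgroup.

Section Families.
Variables (A : zmodType) (B : set (set A)).
Hypothesis Bz : forall U, B U -> GRing.zmod_closed (mem U).

Lemma separated_wrtP :
  separated_wrt B <-> forall a, (forall U, B U -> U a) -> a = 0.
Proof.
split=> [sepB a Ua|sepB a b ab].
  apply: sepB; apply: funext => U; have BU := set_mem (valP U).
  by apply/(eq_cosetP (Bz BU)); rewrite subr0; exact: Ua.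
apply/eqP; rewrite -subr_eq0; apply/eqP/sepB => U BU.
apply/(eq_cosetP (Bz BU)).
exact: (congr1 (fun h => h (exist _ U (mem_set BU))) ab).
Qed.

(** Choosing a representative [w U] of each coset turns points of the completion
    into coherent families of points of [A], which are easier to transport along
    maps than families of cosets. *)
Lemma complete_wrtP :
  complete_wrt B <-> forall w : set A -> A,
    (forall U V, B U -> B V -> U `<=` V -> V (w U - w V)) ->
    exists a, forall U, B U -> U (a - w U).
Proof.
split=> [cB w wB|cB x [xrange xB]].
  have [|a _ aw] := cB (fun U => coset (val U) (w (val U))).
    split=> [U|U V UV a]; first by exists (w (val U)).
    have BU := set_mem (valP U); have BV := set_mem (valP V).
    move/(eq_cosetP (Bz BU)) => /UV Va; apply/(eq_cosetP (Bz BV)).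
    rewrite -(subrKA (w (val U))) -(opprB (w (val U)) (w (val V))).
    apply: (subgroupD (Bz BV)) => //.
    by apply: (subgroupN (Bz BV)); exact: wB.
  exists a => U BU; apply/(eq_cosetP (Bz BU)).
  exact: (congr1 (fun h => h (exist _ U (mem_set BU))) aw).
have /choice[r rP] : forall U : set A, exists a : A,
    forall BU : B U, x (exist _ U (mem_set BU)) = coset U a.
  move=> U; have [BU|nBU] := pselect (B U); last by exists 0.
  have [a _ xa] := xrange (exist _ U (mem_set BU)); exists a => BU'.
  by rewrite (Prop_irrelevance BU' BU) -xa.
have [|a ar] := cB r.
  move=> U V BU BV UV; apply/(eq_cosetP (Bz BV)).
  rewrite -(rP V BV); apply/esym.
  exact: (xB (exist _ U (mem_set BU)) (exist _ V (mem_set BV)) UV _ (rP U BU)).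
exists a => //; apply: funext => -[U UB]; have BU := set_mem UB.
rewrite (bool_irrelevance UB (mem_set BU)) rP.
by apply/(eq_cosetP (Bz BU)); exact: ar.
Qed.

End Families.

(** The notion is relative to [B] so as to cover both the open subgroups of a
    topological group and the open subspaces of a topological vector space. *)
Definition linearly_complete (A : topologicalZmodType) (B : set (set A)) :=
  [/\ forall U, B U -> GRing.zmod_closed (mem U), neighborhood_base0 B,
      separated_wrt B & complete_wrt B].

(** The zero subgroup is the smallest member of [B], so that a coherent family
    converges to its value there. *)
Lemma discrete_linearly_complete (A : topologicalZmodType) (B : set (set A)) :
  nbhs 0 [set (0 : A)] -> (forall U, B U -> GRing.zmod_closed (mem U)) ->
  B [set 0] -> linearly_complete B.
Proof.
move=> A0 Bz B0; split=> //.
- move=> W; split=> [/nbhs_singleton W0|[U BU UW]].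
    by exists [set 0] => // _ ->.
  by apply: filterS A0 => _ ->; exact: UW (subgroup0 (Bz U BU)).
- by apply/separated_wrtP => // a /(_ _ B0).
- apply/complete_wrtP => // w wB; exists (w [set 0]) => U BU; apply: wB => //.
  by move=> _ ->; exact: subgroup0 (Bz U BU).
Qed.

Section CAdditive.
Variables (A B : topologicalZmodType) (f : cadditive A B).

Lemma cadditive_zmod : zmod_morphism f.
Proof. by have /asboolP[] := cadditiveP f. Qed.

Lemma cadditive_continuous : continuous f.
Proof. by have /asboolP[] := cadditiveP f. Qed.

End CAdditive.

Definition mk_cadditive (A B : topologicalZmodType) (f : A -> B)
    (fB : zmod_morphism f) (fc : continuous f) : cadditive A B :=
  @CAdditive A B f (introT (asboolP _) (conj fB fc)).

(** * Fibre products *)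

Section FibreProduct.
Variables (A B C : topologicalZmodType) (f : cadditive B C) (g : cadditive A C).

Definition fibre_pred : {pred B * A} := [pred z | `[< f z.1 = g z.2 >]].

Record fibre_product := FibreProduct {
  fibre_val :> B * A;
  fibre_valP : fibre_val \in fibre_pred }.

HB.instance Definition _ := [isSub for fibre_val].
HB.instance Definition _ := [Choice of fibre_product by <:].

Lemma fibre_zmod_closed : zmod_closed fibre_pred.
Proof.
split=> [|x y /asboolP xfg /asboolP yfg]; apply/asboolP => /=.
  by rewrite !zmod_morphism0//; exact: cadditive_zmod.
by rewrite !cadditive_zmod xfg yfg.
Qed.

HB.instance Definition _ :=
  GRing.isZmodClosed.Build (B * A)%type fibre_pred fibre_zmod_closed.
HB.instance Definition _ := [SubChoice_isSubZmodule of fibre_product by <:].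
HB.instance Definition _ :=
  Topological.copy fibre_product (initial_topology fibre_val).

Lemma fibre_continuous (S : topologicalType) (h : S -> fibre_product) :
  continuous (fun x => (h x : B * A)) -> continuous h.
Proof.
move=> hc; apply/continuousP => _ [O oO <-]; rewrite -comp_preimage.
by move/continuousP: hc; apply.
Qed.

Definition fibre_fst (x : fibre_product) : B := (fibre_val x).1.
Definition fibre_snd (x : fibre_product) : A := (fibre_val x).2.

Lemma fibre_fst_continuous : continuous fibre_fst.
Proof.
move=> x; apply: (@continuous_comp _ _ _ fibre_val fst); last exact: cvg_fst.
exact: initial_continuous.
Qed.

Lemma fibre_snd_continuous : continuous fibre_snd.
Proof.
move=> x; apply: (@continuous_comp _ _ _ fibre_val snd); last exact: cvg_snd.
exact: initial_continuous.
Qed.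

Lemma fibre_fst_zmod : zmod_morphism fibre_fst.
Proof. by []. Qed.

Lemma fibre_snd_zmod : zmod_morphism fibre_snd.
Proof. by []. Qed.

Lemma fibre_sqE x : f (fibre_fst x) = g (fibre_snd x).
Proof. by have /asboolP := fibre_valP x. Qed.

Lemma fibre_ext x y :
  fibre_fst x = fibre_fst y -> fibre_snd x = fibre_snd y -> x = y.
Proof.
move=> e1 e2; apply/val_inj; rewrite /= (surjective_pairing (fibre_val x)).
by rewrite -/(fibre_fst x) -/(fibre_snd x) e1 e2 -surjective_pairing.
Qed.

Lemma fibre_product_sub_continuous :
  continuous (fun z : fibre_product * fibre_product => z.1 - z.2).
Proof.
have subc (E : topologicalZmodType) (h : fibre_product -> E) : continuous h ->
    continuous ((h \o fst : fibre_product * fibre_product -> E) - (h \o snd)).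
  move=> hc; apply: continuousB_fun => z.
    by apply: continuous_comp; [exact: cvg_fst|exact: hc].
  by apply: continuous_comp; [exact: cvg_snd|exact: hc].
apply: fibre_continuous => z.
apply: cvg_pair; first exact: (subc B fibre_fst fibre_fst_continuous).
exact: (subc A fibre_snd fibre_snd_continuous).
Qed.

HB.instance Definition _ := PreTopologicalNmodule_isTopologicalZmodule.Build
  fibre_product fibre_product_sub_continuous.

Definition fibre_pair (b : B) (a : A) (ba : f b = g a) : fibre_product :=
  @FibreProduct (b, a) (introT (asboolP _) ba).

Lemma nbhs_fibre0 (W : set fibre_product) :
  nbhs 0 W -> exists U V, [/\ nbhs 0 U, nbhs 0 V
    & fibre_fst @^-1` U `&` fibre_snd @^-1` V `<=` W].
Proof.
move=> [_ [[O oO <-] O0 OW]].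
have : nbhs (0 : B * A) O by apply: open_nbhs_nbhs.
move=> [[U V] [/= U0 V0] UVO]; exists U, V; split=> // x [Ux Vx].
by apply/OW/UVO.
Qed.

(** [BB], [BA], [BC] and [BP] stand for the open subgroups, or the open
    subspaces, of [B], [A], [C] and of their fibre product. *)
Variables (BB : set (set B)) (BA : set (set A)) (BC : set (set C)).
Variable BP : set (set fibre_product).
Hypotheses (BBl : linearly_complete BB) (BAl : linearly_complete BA).
Hypothesis BCl : linearly_complete BC.
Hypothesis BP_open : forall U, BP U -> GRing.zmod_closed (mem U) /\ open U.
Hypothesis BP_fst : forall U, BB U -> BP (fibre_fst @^-1` U).
Hypothesis BP_snd : forall V, BA V -> BP (fibre_snd @^-1` V).
Hypothesis BP_setI : setI_closed BP.

Lemma fibre_nbhs0_sub (W : set fibre_product) :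
  nbhs 0 W -> exists U V, [/\ BB U, BA V
    & fibre_fst @^-1` U `&` fibre_snd @^-1` V `<=` W].
Proof.
have [_ Bb _ _] := BBl; have [_ Ab _ _] := BAl.
move=> /nbhs_fibre0[U [V [/(Bb U).1[U' BU' U'U] /(Ab V).1[V' AV' V'V] UVW]]].
exists U', V'; split=> // x [U'x V'x].
by apply: UVW; split; [exact: U'U|exact: V'V].
Qed.

(** A coherent family [w] in the fibre product is coherent in both factors,
    along the preimages of their basic subgroups. Let [b] and [a] be its limits
    there. For [U] and [V] basic, [near] says that the point which [w] assigns
    to [fibre_fst @^-1` U `&` fibre_snd @^-1` V] agrees with [b] modulo [U] and
    with [a] modulo [V]; letting [U] and [V] shrink shows that [f b] and [g a]
    agree modulo every basic subgroup of [C], hence are equal, and then that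
    [(b, a)] is the limit of [w]. *)
Lemma fibre_linearly_complete : linearly_complete BP.
Proof.
have [Bz Bb Bs Bc] := BBl; have [Az Ab As Ac] := BAl; have [Cz Cb Cs _] := BCl.
have Pz U : BP U -> GRing.zmod_closed (mem U) by case/BP_open.
have Pnbhs U : BP U -> nbhs 0 U.
  move=> /BP_open[Uz oU]; apply: open_nbhs_nbhs.
  by split=> //; exact: subgroup0.
split=> //.
- move=> W; split=> [/fibre_nbhs0_sub[U [V [BU AV UVW]]]|[U /Pnbhs U0 UW]].
    exists (fibre_fst @^-1` U `&` fibre_snd @^-1` V) => //.
    by apply: BP_setI; [exact: BP_fst|exact: BP_snd].
  exact: filterS UW U0.
- apply/separated_wrtP => // x xP; apply: fibre_ext.
    by apply: (separated_wrtP Bz).1 => // U BU; exact: xP _ (BP_fst BU).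
  by apply: (separated_wrtP Az).1 => // U AU; exact: xP _ (BP_snd AU).
apply/complete_wrtP => // w wP.
have [|b bP] := (complete_wrtP Bz).1 Bc
    (fun U => fibre_fst (w (fibre_fst @^-1` U))).
  move=> U V BU BV UV; rewrite -fibre_fst_zmod.
  by apply: (wP _ _ (BP_fst BU) (BP_fst BV)) => x; exact: UV.
have [|a aP] := (complete_wrtP Az).1 Ac
    (fun V => fibre_snd (w (fibre_snd @^-1` V))).
  move=> U V AU AV UV; rewrite -fibre_snd_zmod.
  by apply: (wP _ _ (BP_snd AU) (BP_snd AV)) => x; exact: UV.
have near U V : BB U -> BA V ->
    let x := w (fibre_fst @^-1` U `&` fibre_snd @^-1` V) in
    U (b - fibre_fst x) /\ V (a - fibre_snd x).
  move=> BU AV x; have PU := BP_fst BU; have PV := BP_snd AV.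
  have PUV := BP_setI PU PV.
  have xU := wP _ _ PUV PU (@subIsetl _ _ _).
  have xV := wP _ _ PUV PV (@subIsetr _ _ _).
  split.
    rewrite -(subrKA (fibre_fst (w (fibre_fst @^-1` U)))).
    apply: (subgroupD (Bz U BU)); first exact: bP.
    by rewrite -opprB; apply: (subgroupN (Bz U BU)); exact: xU.
  rewrite -(subrKA (fibre_snd (w (fibre_snd @^-1` V)))).
  apply: (subgroupD (Az V AV)); first exact: aP.
  by rewrite -opprB; apply: (subgroupN (Az V AV)); exact: xV.
have ba : f b = g a.
  apply/eqP; rewrite -subr_eq0; apply/eqP/(separated_wrtP Cz).1 => // W CW.
  have W0 : nbhs 0 W by apply/Cb; exists W.
  have f0 : nbhs 0 (f @^-1` W).
    apply: cadditive_continuous.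
    by rewrite zmod_morphism0//; exact: cadditive_zmod.
  have g0 : nbhs 0 (g @^-1` W).
    apply: cadditive_continuous.
    by rewrite zmod_morphism0//; exact: cadditive_zmod.
  have [U BU Uf] := (Bb _).1 f0; have [V AV Vg] := (Ab _).1 g0.
  have [/= /Uf fU /Vg gV] := near U V BU AV.
  have := subgroupB (Cz W CW) fU gV.
  by rewrite !cadditive_zmod fibre_sqE opprB addrA subrK.
exists (fibre_pair ba) => T PT.
have [U [V [BU AV UVT]]] := fibre_nbhs0_sub (Pnbhs T PT).
have PUV := BP_setI (BP_fst BU) (BP_snd AV).
rewrite -(subrKA (w (fibre_fst @^-1` U `&` fibre_snd @^-1` V))).
apply: (subgroupD (Pz T PT)); last exact: (wP _ _ PUV PT UVT).
by apply: UVT; exact: near.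
Qed.

End FibreProduct.

(** * Discrete groups and quotients *)

Definition discrete_zmod (M : zmodType) : Type := discrete_topology M.

HB.instance Definition _ (M : zmodType) :=
  DiscreteTopology.copy (discrete_zmod M) (discrete_topology M).
HB.instance Definition _ (M : zmodType) :=
  GRing.Zmodule.copy (discrete_zmod M) M.

Lemma discrete_continuous (S T : topologicalType) (h : S -> T) :
  (forall x : S, nbhs x [set x]) -> continuous h.
Proof.
by move=> Sd x W /nbhs_singleton Wx; apply: filterS (Sd x) => _ ->.
Qed.

Lemma discrete_zmod_sub_continuous (M : zmodType) :
  continuous (fun z : discrete_zmod M * discrete_zmod M => z.1 - z.2).
Proof.
apply: discrete_continuous => -[x y].
exists ([set x], [set y]); first by split; exact: discrete_set1.
by move=> [x' y'] [/= -> ->].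
Qed.

HB.instance Definition _ (M : zmodType) :=
  PreTopologicalNmodule_isTopologicalZmodule.Build (discrete_zmod M)
    (@discrete_zmod_sub_continuous M).

Lemma discrete_zmod_nbhs0 (M : zmodType) : nbhs 0 [set (0 : discrete_zmod M)].
Proof. exact: discrete_set1. Qed.

Section QuotientBySubgroup.
Variables (A : zmodType) (N : set A).
Hypothesis Nz : GRing.zmod_closed (mem N).

(** The proof of closure is an argument, so that the packaged structure of
    closed predicate can be found from the name of the predicate. *)
Definition subgroup_pred of GRing.zmod_closed (mem N) : {pred A} := mem N.
HB.instance Definition _ := GRing.isZmodClosed.Build A (subgroup_pred Nz) Nz.

Definition quotient_by := Quotient.quot (subgroup_pred Nz).
HB.instance Definition _ := GRing.Zmodule.on quotient_by.

Definition quotient_proj (a : A) : quotient_by :=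
  \pi_(Quotient.quot (subgroup_pred Nz)) a.

Lemma quotient_projB : zmod_morphism quotient_proj.
Proof. by move=> x y; rewrite /quotient_proj; exact: raddfB. Qed.

Lemma quotient_proj_eq x y : quotient_proj x = quotient_proj y <-> N (x - y).
Proof.
split=> [/eqP|Nxy]; first by rewrite -Quotient.idealrBE => /set_mem.
by apply/eqP; rewrite -Quotient.idealrBE; exact: mem_set.
Qed.

Lemma quotient_proj_surj x : exists a, quotient_proj a = x.
Proof. by exists (repr x); rewrite /quotient_proj reprK. Qed.

End QuotientBySubgroup.

Definition image_plus (A B : zmodType) (f : B -> A) (U : set A) : set A :=
  [set a | exists b, U (a - f b)].

Lemma image_plus_zmod_closed (A B : zmodType) (f : B -> A) (U : set A) :
  zmod_morphism f -> GRing.zmod_closed (mem U) ->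
  GRing.zmod_closed (mem (image_plus f U)).
Proof.
move=> fB Uz; split=> [|x y /set_mem[b Ub] /set_mem[c Uc]]; apply/mem_set.
  by exists 0; rewrite zmod_morphism0// subr0; exact: subgroup0.
exists (b - c); rewrite fB opprD addrACA -[- y - _]opprD.
exact: subgroupB.
Qed.

(** * Complete separated topological abelian groups *)

Lemma topscZ_linearly_complete (A : topscZ) :
  linearly_complete (@open_subgroups A).
Proof.
split; [by move=> U []|exact: topscZ_linear|exact: topscZ_separated|].
exact: topscZ_complete.
Qed.

Definition topscZ_of (A : topologicalZmodType)
    (Al : linearly_complete (@open_subgroups A)) : topscZ :=
  TopscZObject (let: And4 _ Ab _ _ := Al in Ab)
    (let: And4 _ _ As _ := Al in As) (let: And4 _ _ _ Ac := Al in Ac).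

Lemma set0_zmod_closed (A : zmodType) : GRing.zmod_closed (mem [set (0 : A)]).
Proof.
split=> [|x y /set_mem -> /set_mem ->]; apply/mem_set => //.
by rewrite subr0.
Qed.

Lemma discrete_topscZ_subproof (M : zmodType) :
  linearly_complete (@open_subgroups (discrete_zmod M)).
Proof.
apply: discrete_linearly_complete; first exact: discrete_zmod_nbhs0.
  by move=> U [].
by split; [exact: set0_zmod_closed|exact: discrete_open].
Qed.

Definition discrete_topscZ (M : zmodType) : topscZ :=
  topscZ_of (discrete_topscZ_subproof M).

Lemma preimage_open_subgroup (A B : topologicalZmodType) (f : A -> B)
    (U : set B) :
  zmod_morphism f -> continuous f ->
  open_subgroups U -> open_subgroups (f @^-1` U).
Proof.
move=> fB /continuousP fc [Uz Uo]; split; last exact: fc.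
split=> [|x y /set_mem Ux /set_mem Uy]; apply/mem_set => /=.
  by rewrite zmod_morphism0//; exact: subgroup0.
by rewrite fB; exact: subgroupB.
Qed.

Lemma open_subgroupsI (A : topologicalZmodType) :
  setI_closed (@open_subgroups A).
Proof.
move=> U V [Uz Uo] [Vz Vo]; split; last exact: openI.
split=> [|x y /set_mem[Ux Vx] /set_mem[Uy Vy]]; apply/mem_set.
  by split; exact: subgroup0.
by split; exact: subgroupB.
Qed.

Lemma topscZ_fibre_subproof (A B C : topscZ) (f : cadditive B C)
    (g : cadditive A C) :
  linearly_complete (@open_subgroups (fibre_product f g)).
Proof.
apply: fibre_linearly_complete; do ?exact: topscZ_linearly_complete.
- by [].
- move=> U; apply: preimage_open_subgroup; first exact: fibre_fst_zmod.
  exact: fibre_fst_continuous.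
- move=> U; apply: preimage_open_subgroup; first exact: fibre_snd_zmod.
  exact: fibre_snd_continuous.
- exact: open_subgroupsI.
Qed.

Definition topscZ_fibre (A B C : topscZ) (f : cadditive B C)
    (g : cadditive A C) : topscZ :=
  topscZ_of (topscZ_fibre_subproof f g).

Lemma cadditive_inj (A B : topologicalZmodType) (f g : cadditive A B) :
  f =1 g -> f = g.
Proof. by move=> fg; apply/val_inj/funext. Qed.

Lemma topscZ_discrete_generator (A : topscZ) (a : A) :
  exists (G : topscZ) (e : G) (f : cadditive G A),
    nbhs 0 [set (0 : G)] /\ f e = a.
Proof.
pose h : discrete_zmod int -> A := fun n => a *~ n.
have hB : zmod_morphism h by move=> m n; rewrite /h mulrzBr.
have hc : continuous h by apply: discrete_continuous => x; exact: discrete_set1.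
exists (discrete_topscZ int), (1 : int), (mk_cadditive hB hc).
split; first exact: discrete_zmod_nbhs0.
exact: mulr1z.
Qed.

(** Adding to the image of [f] an open subgroup contained in [W] gives an open
    subgroup, so that the projection to the discrete quotient is continuous. *)
Lemma topscZ_discrete_quotient (B A : topscZ) (f : cadditive B A) (W : set A) :
  nbhs 0 W -> exists (D : topscZ) (g : cadditive A D),
    [/\ nbhs 0 [set (0 : D)], cadditive_comp g f = 0
      & forall a, g a = 0 -> exists b, W (a - f b)].
Proof.
move=> /topscZ_linear[U [Uz Uo] UW].
have Nz := image_plus_zmod_closed (cadditive_zmod f) Uz.
pose g : A -> discrete_zmod (quotient_by Nz) := quotient_proj Nz.
have gB : zmod_morphism g := @quotient_projB _ _ Nz.
have g0 a : g a = 0 <-> exists b, U (a - f b).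
  by rewrite -(zmod_morphism0 gB) quotient_proj_eq subr0.
have gc : continuous g.
  apply: kernel_nbhs_continuous => //; apply: (@filterS _ _ _ U).
    move=> u Uu; apply/g0; exists 0.
    by rewrite (zmod_morphism0 (cadditive_zmod f)) subr0.
  by apply: open_nbhs_nbhs; split=> //; exact: subgroup0.
exists (discrete_topscZ (quotient_by Nz)), (mk_cadditive gB gc); split.
- exact: discrete_zmod_nbhs0.
- apply: cadditive_inj => b; apply/g0; exists b.
  by rewrite subrr; exact: subgroup0.
by move=> a /g0[b Ub]; exists b; exact: UW.
Qed.

Lemma topscZ_pullback (A B C : topscZ) (f : cadditive B C) (g : cadditive A C) :
  exists (P : topscZ) (q1 : cadditive P B) (q2 : cadditive P A),
    [/\ @is_pullback TopscZ _ _ _ _ f g q1 q2,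
        forall b a, f b = g a -> exists x, q1 x = b /\ q2 x = a
      & forall W, nbhs 0 W -> exists U V, [/\ nbhs 0 U, nbhs 0 V
          & q1 @^-1` U `&` q2 @^-1` V `<=` W]].
Proof.
exists (topscZ_fibre f g),
  (mk_cadditive (@fibre_fst_zmod _ _ _ f g) (@fibre_fst_continuous _ _ _ f g)),
  (mk_cadditive (@fibre_snd_zmod _ _ _ f g) (@fibre_snd_continuous _ _ _ f g)).
split; last exact: nbhs_fibre0.
- split; first by apply: cadditive_inj => x; exact: fibre_sqE.
  move=> Q r1 r2 r12.
  have rE x : f (r1 x) = g (r2 x) := congr1 (fun h : cadditive Q C => h x) r12.
  have uB : zmod_morphism (fun x => fibre_pair (rE x)).
    by move=> x y; apply: fibre_ext; exact: cadditive_zmod.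
  have uc : continuous (fun x => fibre_pair (rE x)).
    apply: fibre_continuous => x.
    by apply: cvg_pair; exact: cadditive_continuous.
  exists (mk_cadditive uB uc : cadditive Q (topscZ_fibre f g)); split.
    by split; apply: cadditive_inj.
  move=> u [ur1 ur2]; apply: cadditive_inj => x; apply: fibre_ext.
    exact: (congr1 (fun h : cadditive Q B => h x) (esym ur1)).
  exact: (congr1 (fun h : cadditive Q A => h x) (esym ur2)).
by move=> b a ba; exists (fibre_pair ba).
Qed.

Lemma topscZ_descent (A C D : topscZ) (p : cadditive A C) (g : cadditive A D) :
  set_surj [set: A] [set: C] p -> open_map p ->
  (forall a, p a = 0 -> g a = 0) ->
  exists h : cadditive C D, cadditive_comp h p = g.
Proof.
move=> psurj pop pg.
have [h hc hp] := surj_open_quotient psurj pop (cadditive_zmod p)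
  (cadditive_zmod g) (@cadditive_continuous _ _ g) pg.
have hB : zmod_morphism h.
  move=> c d; have [a _ <-] := psurj c I; have [b _ <-] := psurj d I.
  by rewrite -cadditive_zmod !hp cadditive_zmod.
by exists (mk_cadditive hB hc); apply: cadditive_inj => a; exact: hp.
Qed.

Theorem topscZ_semistable (A C : topscZ) (p : cadditive A C) :
  @is_semistable_cokernel TopscZ A C p <->
  set_surj [set: A] [set: C] p /\ open_map p.
Proof.
apply: (@semistable_cokernelP TopscZ (fun A => A : topologicalZmodType)
  (fun A B (f : cadditive A B) => f : A -> B)).
- exact: @cadditive_inj.
- by [].
- by [].
- by move=> *; exact: cadditive_zmod.
- by move=> *; exact: cadditive_continuous.
- exact: topscZ_discrete_generator.
- exact: topscZ_discrete_quotient.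
- exact: topscZ_pullback.
- exact: topscZ_descent.
Qed.

(** * Quotients by vector subspaces *)

Section QuotientBySubspace.
Variables (k : fieldType) (L : lmodType k) (N : set L).
Hypothesis Ns : GRing.submod_closed (mem N).

Lemma subspaceZ a x : N x -> N (a *: x).
Proof.
move=> Nx; have [/set_mem N0 Nl] := Ns; apply/set_mem.
by rewrite -[_ *: _]addr0; apply: Nl; apply/mem_set.
Qed.

Let Nz : GRing.zmod_closed (mem N) := GRing.submod_closedB Ns.

Definition quotient_space := quotient_by Nz.
HB.instance Definition _ :=
  GRing.Zmodule.copy quotient_space (quotient_by Nz).

Definition quotient_scale (a : k) (x : quotient_space) : quotient_space :=
  quotient_proj Nz (a *: (repr x : L)).

Lemma quotient_projZ a x :
  quotient_scale a (quotient_proj Nz x) = quotient_proj Nz (a *: x).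
Proof.
apply/quotient_proj_eq; rewrite -scalerBr; apply: subspaceZ.
by apply/quotient_proj_eq; rewrite /quotient_proj reprK.
Qed.

Let projD := zmod_morphismD (@quotient_projB _ _ Nz).

Fact quotient_scalerA a b x :
  quotient_scale a (quotient_scale b x) = quotient_scale (a * b) x.
Proof.
by have [v <-] := quotient_proj_surj x; rewrite !quotient_projZ scalerA.
Qed.

Fact quotient_scale1r : left_id 1 quotient_scale.
Proof.
move=> x; have [v <-] := quotient_proj_surj x.
by rewrite quotient_projZ scale1r.
Qed.

Fact quotient_scalerDr : right_distributive quotient_scale +%R.
Proof.
move=> a x y; have [v <-] := quotient_proj_surj x.
have [w <-] := quotient_proj_surj y.
by rewrite -projD !quotient_projZ -projD scalerDr.
Qed.

Fact quotient_scalerDl x : {morph quotient_scale^~ x : a b / a + b}.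
Proof.
move=> a b; have [v <-] := quotient_proj_surj x.
by rewrite !quotient_projZ -projD scalerDl.
Qed.

HB.instance Definition _ := GRing.Zmodule_isLmodule.Build k quotient_space
  quotient_scalerA quotient_scale1r quotient_scalerDr quotient_scalerDl.

Definition quotient_space_proj (v : L) : quotient_space := quotient_proj Nz v.

Lemma quotient_space_proj_linear : linear quotient_space_proj.
Proof. by move=> a x y; rewrite /quotient_space_proj projD -quotient_projZ. Qed.

Lemma quotient_space_proj0 v : quotient_space_proj v = 0 <-> N v.
Proof.
by rewrite -(zmod_morphism0 (@quotient_projB _ _ Nz)) quotient_proj_eq subr0.
Qed.

End QuotientBySubspace.

Lemma linear_zmod_morphism (k : fieldType) (L M : lmodType k) (f : L -> M) :
  linear f -> zmod_morphism f.
Proof. by move=> fl x y; rewrite -scaleN1r addrC fl scaleN1r addrC. Qed.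

Lemma linear_scale (k : fieldType) (L M : lmodType k) (f : L -> M) :
  linear f -> forall a x, f (a *: x) = a *: f x.
Proof.
move=> fl a x; rewrite -[a *: x]addr0 fl.
by rewrite (zmod_morphism0 (linear_zmod_morphism fl)) addr0.
Qed.

(** * Complete separated topological vector spaces *)

Section Vectors.
Variable k : fieldType.

Section CLinear.
Variables (V W : topologicalVectType k) (f : clinear V W).

Lemma clinear_linear : linear f.
Proof. by have /asboolP[] := clinearP f. Qed.

Lemma clinear_zmod : zmod_morphism f.
Proof. exact: linear_zmod_morphism clinear_linear. Qed.

Lemma clinear_continuous : continuous f.
Proof. by have /asboolP[] := clinearP f. Qed.

Definition clinear_cadditive : cadditive V W :=
  mk_cadditive clinear_zmod clinear_continuous.

End CLinear.

Definition mk_clinear (V W : topologicalVectType k) (f : V -> W)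
    (fl : linear f) (fc : continuous f) : clinear V W :=
  @CLinear k V W f (introT (asboolP _) (conj fl fc)).

Lemma clinear_inj (V W : topologicalVectType k) (f g : clinear V W) :
  f =1 g -> f = g.
Proof. by move=> fg; apply/val_inj/funext. Qed.

Lemma scale_continuousr (V : topologicalVectType k) (a : k) :
  continuous (fun v : V => a *: v).
Proof.
move=> v Y /(@tv_scale_continuous k V (a, v))[[P Q] [/= Pa Qv] PQ].
apply: filterS Qv => w Qw; apply: (PQ (a, w)); split=> //=.
exact: nbhs_singleton Pa.
Qed.

(** Since the scalars are discrete, continuity of the scaling has to be checked
    for one scalar at a time. *)
Lemma scale_continuous_pointwise (V : topologicalType) (s : k -> V -> V) :
  (forall a, continuous (s a)) ->
  continuous (fun z : discrete_topology k * V => s z.1 z.2).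
Proof.
move=> sc [a v] W /= /(sc a v) Wav; exists ([set a], s a @^-1` W).
  by split=> //; exact: discrete_set1.
by move=> [b w] [/= -> Ww].
Qed.

Lemma topsck_linearly_complete (V : topsck k) :
  linearly_complete (@open_subspaces k V).
Proof.
split; last exact: topsck_complete.
- by move=> U [/GRing.submod_closedB].
- exact: topsck_linear.
- exact: topsck_separated.
Qed.

Definition topsck_of (V : topologicalVectType k)
    (Vl : linearly_complete (@open_subspaces k V)) : topsck k :=
  TopsckObject (let: And4 _ Ab _ _ := Vl in Ab)
    (let: And4 _ _ As _ := Vl in As) (let: And4 _ _ _ Ac := Vl in Ac).

Definition discrete_vect (L : lmodType k) : topologicalVectType k :=
  @TopologicalVectType k (discrete_zmod L) (fun a (v : L) => a *: v)
    (@scalerA k L) (@scale1r k L) (@scalerDr k L) (fun v a b => scalerDl v a b)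
    (scale_continuous_pointwise (V := discrete_zmod L)
      (fun a => @discrete_continuous (discrete_zmod L) (discrete_zmod L) _
        (@discrete_set1 _))).

Lemma set0_submod_closed (L : lmodType k) :
  GRing.submod_closed (mem [set (0 : L)]).
Proof.
split=> [|a x y /set_mem -> /set_mem ->]; apply/mem_set => //.
by rewrite /= scaler0 addr0.
Qed.

Lemma discrete_topsck_subproof (L : lmodType k) :
  linearly_complete (@open_subspaces k (discrete_vect L)).
Proof.
apply: discrete_linearly_complete; first exact: discrete_zmod_nbhs0.
  by move=> U [/GRing.submod_closedB].
split; first exact: (@set0_submod_closed (discrete_vect L)).
exact: (@discrete_open (discrete_zmod L)).
Qed.

Definition discrete_topsck (L : lmodType k) : topsck k :=
  topsck_of (discrete_topsck_subproof L).

(** Scaling acts componentwise on the fibre product of the underlying groups, so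
    that its topology and its completeness come from the case of groups. *)
Section FibreVect.
Variables (V W X : topologicalVectType k) (f : clinear W X) (g : clinear V X).

Let F := fibre_product (clinear_cadditive f) (clinear_cadditive g).

Lemma fibre_scale_subproof (a : k) (x : F) :
  f (a *: (fibre_fst x : W)) = g (a *: (fibre_snd x : V)).
Proof.
rewrite (linear_scale (clinear_linear f)) (linear_scale (clinear_linear g)).
by congr (_ *: _); exact: (fibre_sqE x).
Qed.

Definition fibre_scale (a : k) (x : F) : F :=
  @fibre_pair _ _ _ (clinear_cadditive f) (clinear_cadditive g) _ _
    (fibre_scale_subproof a x).

Fact fibre_scalerA a b x :
  fibre_scale a (fibre_scale b x) = fibre_scale (a * b) x.
Proof. by apply: fibre_ext; exact: scalerA. Qed.

Fact fibre_scale1r : left_id 1 fibre_scale.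
Proof. by move=> x; apply: fibre_ext; exact: scale1r. Qed.

Fact fibre_scalerDr : right_distributive fibre_scale +%R.
Proof. by move=> a x y; apply: fibre_ext; exact: scalerDr. Qed.

Fact fibre_scalerDl x : {morph fibre_scale^~ x : a b / a + b}.
Proof. by move=> a b; apply: fibre_ext; exact: scalerDl. Qed.

Fact fibre_scale_continuous :
  continuous (fun z : discrete_topology k * F => fibre_scale z.1 z.2).
Proof.
apply: scale_continuous_pointwise => a; apply: fibre_continuous => x.
have c1 : continuous (fun x : F => a *: (fibre_fst x : W)).
  move=> y; apply: (@continuous_comp F W W (fun z => fibre_fst z)
    (fun w => a *: w)).
    exact: fibre_fst_continuous.
  exact: scale_continuousr.
have c2 : continuous (fun x : F => a *: (fibre_snd x : V)).
  move=> y; apply: (@continuous_comp F V V (fun z => fibre_snd z)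
    (fun v => a *: v)).
    exact: fibre_snd_continuous.
  exact: scale_continuousr.
exact: (cvg_pair (c1 x) (c2 x)).
Qed.

Definition fibre_vect : topologicalVectType k :=
  TopologicalVectType fibre_scalerA fibre_scale1r fibre_scalerDr fibre_scalerDl
    fibre_scale_continuous.

Lemma fibre_fst_linear : linear (@fibre_fst _ _ _ _ _ : fibre_vect -> W).
Proof. by []. Qed.

Lemma fibre_snd_linear : linear (@fibre_snd _ _ _ _ _ : fibre_vect -> V).
Proof. by []. Qed.

End FibreVect.

Lemma preimage_open_subspace (V W : topologicalVectType k) (f : V -> W)
    (U : set W) :
  linear f -> continuous f -> open_subspaces U -> open_subspaces (f @^-1` U).
Proof.
move=> fl /continuousP fc [[/set_mem U0 Ul] Uo]; split; last exact: fc.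
split=> [|a x y /set_mem Ux /set_mem Uy]; apply/mem_set => /=.
  by rewrite (zmod_morphism0 (linear_zmod_morphism fl)).
by rewrite fl; apply/set_mem/Ul; exact: mem_set.
Qed.

Lemma open_subspacesI (V : topologicalVectType k) :
  setI_closed (@open_subspaces k V).
Proof.
move=> U U' [[/set_mem U0 Ul] Uo] [[/set_mem U'0 U'l] U'o].
split; last exact: openI.
split=> [|a x y /set_mem[Ux U'x] /set_mem[Uy U'y]]; apply/mem_set => //.
by split; apply/set_mem; [apply: Ul|apply: U'l]; exact: mem_set.
Qed.

Lemma image_plus_submod_closed (V W : lmodType k) (f : W -> V) (U : set V) :
  linear f -> GRing.submod_closed (mem U) ->
  GRing.submod_closed (mem (image_plus f U)).
Proof.
move=> fl Us; have Uz := GRing.submod_closedB Us.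
split=> [|a x y /set_mem[b Ub] /set_mem[c Uc]]; apply/mem_set.
  exists 0; rewrite (zmod_morphism0 (linear_zmod_morphism fl)) subr0.
  exact: subgroup0.
exists (a *: b + c); rewrite fl opprD addrACA -scalerBr.
by apply: subgroupD => //; exact: subspaceZ.
Qed.

Lemma topsck_fibre_subproof (V W X : topsck k) (f : clinear W X)
    (g : clinear V X) :
  linearly_complete (@open_subspaces k (fibre_vect f g)).
Proof.
apply: (fibre_linearly_complete (topsck_linearly_complete W)
  (topsck_linearly_complete V) (topsck_linearly_complete X)).
- by move=> U [/GRing.submod_closedB].
- move=> U; apply: (@preimage_open_subspace (fibre_vect f g)).
    exact: fibre_fst_linear.
  exact: fibre_fst_continuous.
- move=> U; apply: (@preimage_open_subspace (fibre_vect f g)).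
    exact: fibre_snd_linear.
  exact: fibre_snd_continuous.
- exact: (@open_subspacesI (fibre_vect f g)).
Qed.

Definition topsck_fibre (V W X : topsck k) (f : clinear W X) (g : clinear V X) :
  topsck k := topsck_of (topsck_fibre_subproof f g).

Lemma topsck_discrete_generator (V : topsck k) (v : V) :
  exists (G : topsck k) (e : G) (f : clinear G V),
    nbhs 0 [set (0 : G)] /\ f e = v.
Proof.
pose h : discrete_vect k^o -> V := fun a => (a : k) *: v.
have hl : linear h by move=> a x y; rewrite /h scalerDl scalerA.
have hc : continuous h.
  apply: discrete_continuous => x.
  exact: (@discrete_set1 (discrete_zmod k^o)).
exists (discrete_topsck k^o), (1 : k), (mk_clinear hl hc).
split; first exact: discrete_zmod_nbhs0.
exact: scale1r.
Qed.

Lemma topsck_discrete_quotient (W V : topsck k) (f : clinear W V) (Y : set V) :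
  nbhs 0 Y -> exists (D : topsck k) (g : clinear V D),
    [/\ nbhs 0 [set (0 : D)], clinear_comp g f = 0
      & forall a, g a = 0 -> exists b, Y (a - f b)].
Proof.
move=> /topsck_linear[U [Us Uo] UY].
have Ns := image_plus_submod_closed (clinear_linear f) Us.
have U0 := subgroup0 (GRing.submod_closedB Us).
pose g : V -> discrete_vect (quotient_space Ns) := quotient_space_proj Ns.
have gl : linear g := @quotient_space_proj_linear _ _ _ Ns.
have g0 a : g a = 0 <-> exists b, U (a - f b) := quotient_space_proj0 Ns a.
have gc : continuous g.
  apply: kernel_nbhs_continuous; first exact: linear_zmod_morphism.
  apply: (@filterS _ _ _ U); last by apply: open_nbhs_nbhs.
  move=> u Uu; apply/g0; exists 0.
  by rewrite (zmod_morphism0 (clinear_zmod f)) subr0.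
exists (discrete_topsck (quotient_space Ns)), (mk_clinear gl gc); split.
- exact: discrete_zmod_nbhs0.
- by apply: clinear_inj => b; apply/g0; exists b; rewrite subrr.
by move=> a /g0[b Ub]; exists b; exact: UY.
Qed.

Lemma topsck_pullback (V W X : topsck k) (f : clinear W X) (g : clinear V X) :
  exists (P : topsck k) (q1 : clinear P W) (q2 : clinear P V),
    [/\ @is_pullback (Topsck k) _ _ _ _ f g q1 q2,
        forall b a, f b = g a -> exists x, q1 x = b /\ q2 x = a
      & forall Y, nbhs 0 Y -> exists U U', [/\ nbhs 0 U, nbhs 0 U'
          & q1 @^-1` U `&` q2 @^-1` U' `<=` Y]].
Proof.
pose P : topsck k := topsck_fibre f g.
have q1c := @fibre_fst_continuous _ _ _ (clinear_cadditive f)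
  (clinear_cadditive g).
have q2c := @fibre_snd_continuous _ _ _ (clinear_cadditive f)
  (clinear_cadditive g).
exists P, (@mk_clinear P W _ (@fibre_fst_linear _ _ _ f g) q1c),
  (@mk_clinear P V _ (@fibre_snd_linear _ _ _ f g) q2c).
split; last exact: nbhs_fibre0.
- split; first by apply: clinear_inj => x; exact: (fibre_sqE x).
  move=> Q r1 r2 r12.
  have rE x : clinear_cadditive f (r1 x) = clinear_cadditive g (r2 x) :=
    congr1 (fun h : clinear Q X => h x) r12.
  pose u : Q -> P := fun x => fibre_pair (rE x).
  have ul : linear u.
    by move=> a x y; apply: fibre_ext; exact: clinear_linear.
  have uc : continuous u.
    by apply: fibre_continuous => x; apply: cvg_pair; exact: clinear_continuous.
  exists (mk_clinear ul uc : clinear Q P); split.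
    by split; apply: clinear_inj.
  move=> u' [ur1 ur2]; apply: clinear_inj => x; apply: fibre_ext.
    exact: (congr1 (fun h : clinear Q W => h x) (esym ur1)).
  exact: (congr1 (fun h : clinear Q V => h x) (esym ur2)).
move=> b a ba.
by exists (@fibre_pair _ _ _
  (clinear_cadditive f) (clinear_cadditive g) _ _ ba).
Qed.

Lemma topsck_descent (V W X : topsck k) (p : clinear V W) (g : clinear V X) :
  set_surj [set: V] [set: W] p -> open_map p ->
  (forall a, p a = 0 -> g a = 0) ->
  exists h : clinear W X, clinear_comp h p = g.
Proof.
move=> psurj pop pg.
have [h hc hp] := surj_open_quotient psurj pop (clinear_zmod p)
  (clinear_zmod g) (@clinear_continuous _ _ g) pg.
have hl : linear h.
  move=> r c d; have [a _ <-] := psurj c I; have [b _ <-] := psurj d I.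
  by rewrite -clinear_linear !hp clinear_linear.
by exists (mk_clinear hl hc); apply: clinear_inj => a; exact: hp.
Qed.

Theorem topsck_semistable (V W : topsck k) (p : clinear V W) :
  @is_semistable_cokernel (Topsck k) V W p <->
  set_surj [set: V] [set: W] p /\ open_map p.
Proof.
apply: (@semistable_cokernelP (Topsck k)
  (fun V : topsck k => V : topologicalZmodType)
  (fun V W (f : clinear V W) => f : V -> W)).
- by move=> A B; exact: clinear_inj.
- by [].
- by [].
- by move=> *; exact: clinear_zmod.
- by move=> *; exact: clinear_continuous.
- exact: topsck_discrete_generator.
- exact: topsck_discrete_quotient.
- exact: topsck_pullback.
- exact: topsck_descent.
Qed.

End Vectors.

Theorem proposition8p4 (k : fieldType) :
  (forall (A C : topscZ) (p : cadditive A C),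
     @is_semistable_cokernel TopscZ A C p <->
     set_surj [set: A] [set: C] p /\ open_map p) /\
  (forall (V W : topsck k) (p : clinear V W),
     @is_semistable_cokernel (Topsck k) V W p <->
     set_surj [set: V] [set: W] p /\ open_map p).
Proof.
by split=> [A C p|V W p]; [exact: topscZ_semistable|exact: topsck_semistable].
Qed.
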